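(* Let $\mathcal{R}=(R_{ij})_{i,j=1}^\infty$ be the infinite symbolic recurrence plot (with embedding dimension $1$) of the period-doubling sequence $x=(x_i)_{i\ge1}$. Put $M_1=\{i\in\mathbb N: x_i=1\}$ and \[ A=(2M_1-1)\times(2M_1+1)\ \sqcup\ (2M_1)\times\big((4M_1-1)\sqcup(4M_1+1)\big), \] \[ B=(2M_1-1)\sqcup(2M_1),\qquad C=(2M_1-1)\times(2M_1). \] Let $\ell\ge1$ and $i,j\ge1$ be integers. Then $(i,j)$ is a starting point of a diagonal line of length $\ell$ in $\mathcal R$ if and only if (exactly) one of the following two cases happens: (1) $\ell=2^{k+1}-1$ for some integer $k\ge0$, and either $(i,j)$ or $(j,i)$ belongs to the union of the sets $2^kA-(2^k-1)$ and $[2^kB-(2^k-1)]\times\{1\}$; (2) $\ell=3\cdot2^k-1$ for some integer $k\ge0$, and either $(i,j)$ or $(j,i)$ belongs to the set $2^kC-(2^k-1)$. In both cases, every diagonal line of length $\ell$ is determined by the word $x_1x_2\dots x_\ell$. Consequently, the density in $\mathbb N^2$ of the set of starting points of diagonal lines of length $\ell\ge1$ is \[ \mathrm d_\ell=\frac{c_\ell}{(\ell+1)^2},\qquad\text{where}\quad c_\ell=\begin{cases}4/9&\text{if }\ell=2^{k+1}-1\text{ for some }k\ge0;\\ 1/2&\text{if }\ell=3\cdot2^k-1\text{ for some }k\ge0;\\ 0&\text{otherwise.}\end{cases} \]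
   Context: $\mathbb N$ is the set of positive integers. The period-doubling sequence $x=(x_i)_{i\ge1}$ is defined by $x_i=k_i \bmod 2$, where $k_i\ge0$ is the largest integer such that $2^{k_i}$ divides $i$. Its infinite symbolic recurrence plot with embedding dimension $1$ is $\mathcal R=(R_{ij})_{i,j=1}^\infty$, where $R_{ij}=1$ if $x_i=x_j$ and $R_{ij}=0$ otherwise. For distinct $i,j\in\mathbb N$ (the main diagonal is excluded) and $\ell\ge1$, $(i,j)$ is the starting point of a diagonal line of length $\ell$ in $\mathcal R$ if $R_{i+h,j+h}=1$ for every $0\le h<\ell$, $R_{i+\ell,j+\ell}=0$, and, provided $\min\{i,j\}\ge2$, $R_{i-1,j-1}=0$. A diagonal line of length $\ell$ starting at $(i,j)$ is determined by the word $w$ if $x_ix_{i+1}\dots x_{i+\ell-1}=x_jx_{j+1}\dots x_{j+\ell-1}=w$. For a subset $S$ of $\mathbb R^h$ and real $a,b$, $aS+b=\{as+b: s\in S\}$, where $b$ is added to every coordinate. The symbol $\sqcup$ denotes disjoint union. The density of $S\subseteq\mathbb N^h$ is $d(S)=\lim_{n\to\infty}n^{-h}\,\#\{(s_1,\dots,s_h)\in S: s_r\le n\text{ for all }r\}$, provided the limit exists.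
   Formalization: In case (2), ℓ=3·2^k−1, the determining word x_1…x_ℓ is replaced by x_{2^{k+1}+1}…x_{2^{k+1}+ℓ}: the original is false, as (3,4) starts a line of length 2 with word 00 while x_1x_2=01. *)

(* Defs.v *)
From mathcomp Require Import all_boot all_order all_algebra.
From mathcomp Require Import all_classical all_reals all_analysis.

Set Implicit Arguments.
Unset Strict Implicit.
Unset Printing Implicit Defensive.

Import Order.TTheory GRing.Theory Num.Theory numFieldNormedType.Exports.

Local Open Scope classical_set_scope.
Local Open Scope ring_scope.

(* Sequences, plots and starting points are indexed by [nat]; only indices
   [>= 1] are meaningful, and [diag_start] rules out the index 0. *)

(* [logn 2 i] is the largest [k] with [2 ^ k %| i], for [i >= 1]. *)
Definition pd (i : nat) : nat := (logn 2 i %% 2)%N.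

Definition recplot (i j : nat) : nat := if pd i == pd j then 1%N else 0%N.

Definition diag_start (l i j : nat) : Prop :=
  [/\ [/\ (0 < i)%N, (0 < j)%N & i != j],
      (0 < l)%N,
      forall h : nat, (h < l)%N -> recplot (i + h) (j + h) = 1%N,
      recplot (i + l) (j + l) = 0%N
    & (2 <= minn i j)%N -> recplot i.-1 j.-1 = 0%N].

Definition pd_word (i l : nat) : seq nat := [seq pd (i + h) | h <- iota 0 l].

(* A line of length [2 ^ k.+1 - 1] is determined by the prefix [pd_word 1 l].
   A line of length [3 * 2 ^ k - 1] is not: (3, 4) starts a line of length 2
   with word 00, while the prefix is 01; the determining word is then the
   factor [pd_word (2 ^ k.+1 + 1) l]. *)
Definition determined_by (w : seq nat) (l i j : nat) : Prop :=
  pd_word i l = w /\ pd_word j l = w.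

Definition affine1 (T : pzRingType) (a b : T) (S : set T) : set T :=
  [set a * s + b | s in S].

Definition affine2 (T : pzRingType) (a b : T) (S : set (T * T)) : set (T * T) :=
  [set (a * s.1 + b, a * s.2 + b) | s in S].

(* The sets below live in [int], so that no subtraction is truncated. *)
Definition M1 : set int := [set i%:Z | i in [set i : nat | (0 < i)%N /\ pd i = 1%N]].

Definition A1 : set (int * int) := affine1 2 (-1) M1 `*` affine1 2 1 M1.

Definition A2 : set (int * int) :=
  affine1 2 0 M1 `*` (affine1 4 (-1) M1 `|` affine1 4 1 M1).

Definition A : set (int * int) := A1 `|` A2.

Definition B : set int := affine1 2 (-1) M1 `|` affine1 2 0 M1.

Definition C : set (int * int) := affine1 2 (-1) M1 `*` affine1 2 0 M1.

Definition case1_set (k : nat) : set (int * int) :=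
  affine2 (2 ^+ k) (- (2 ^+ k - 1)) A
  `|` affine1 (2 ^+ k) (- (2 ^+ k - 1)) B `*` [set 1].

Definition case2_set (k : nat) : set (int * int) :=
  affine2 (2 ^+ k) (- (2 ^+ k - 1)) C.

Definition case1 (l i j : nat) : Prop :=
  exists k : nat, l = (2 ^ k.+1 - 1)%N /\
    (case1_set k (i%:Z, j%:Z) \/ case1_set k (j%:Z, i%:Z)).

Definition case2 (l i j : nat) : Prop :=
  exists k : nat, l = (3 * 2 ^ k - 1)%N /\
    (case2_set k (i%:Z, j%:Z) \/ case2_set k (j%:Z, i%:Z)).

(* An ordinal [p : 'I_n] stands for the integer [p.+1] of {1, ..., n}. *)
Definition count_upto (S : set (nat * nat)) (n : nat) : nat :=
  #|[pred p : 'I_n * 'I_n | (p.1.+1, p.2.+1) \in S]|.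

Definition has_density (R : realType) (S : set (nat * nat)) (d : R) : Prop :=
  (fun n : nat => (count_upto S n)%:R / n%:R ^+ 2 : R) @ \oo --> d.

Definition density_const (R : realType) (l : nat) : R :=
  if `[< exists k : nat, l = (2 ^ k.+1 - 1)%N >] then 4 / 9
  else if `[< exists k : nat, l = (3 * 2 ^ k - 1)%N >] then 1 / 2
  else 0.

(* Main.v *)
(* The sequence is the fixed point of the period-doubling substitution: it
   vanishes at odd positions, and position 2i carries the negation of position
   i. Hence a diagonal line of length 2m+1 starting at (2i-1, 2j-1) is the
   substitution image of a line of length m starting at (i, j). No line
   starts at two even indices, since their predecessors agree, and two
   consecutive even positions cannot both carry 0; so every line of length
   at least 3 starts at two odd indices, has odd length and arises in this
   way. Everything reduces to the lengths 1 and 2, which only involve the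
   neighbours of the two indices. For the densities, the lines of length
   2m+1 in the square of side n correspond to those of length m in the
   square of side ceil(n/2), and the starting points of lines of length 1
   and 2 form finite disjoint unions of products of sets of density 1/6. *)
Require Import Defs.
From mathcomp Require Import all_boot all_order all_algebra.
From mathcomp Require Import all_classical all_reals all_analysis.
From mathcomp Require Import zify ring lra.

Set Implicit Arguments.
Unset Strict Implicit.
Unset Printing Implicit Defensive.

Import Order.TTheory GRing.Theory Num.Theory numFieldNormedType.Exports.

Local Open Scope classical_set_scope.
Local Open Scope ring_scope.

(** * The period-doubling sequence and its substitution rule *)

Definition pdb (i : nat) : bool := odd (logn 2 i).

Lemma pdE i : pd i = pdb i.
Proof. by rewrite /pd modn2. Qed.

Lemma pdb_odd i : odd i -> pdb i = false.
Proof.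
move=> oi; suff -> : i = (i./2.*2 + 1)%N.
  by rewrite /pdb lognE dvdn2 oddD odd_double /= andbF.
by rewrite -[LHS]odd_double_half oi addnC.
Qed.

Lemma pdb_double i : (0 < i)%N -> pdb i.*2 = ~~ pdb i.
Proof. by move=> i0; rewrite /pdb -mul2n lognM. Qed.

Lemma pdb_even i : ~~ odd i -> (0 < i)%N -> pdb i = ~~ pdb i./2.
Proof.
move=> ei i0; rewrite -pdb_double; last lia.
by rewrite even_halfK.
Qed.

(** The halves of the even numbers [i.-1] and [i.+1] are consecutive, so one of them is odd and
    carries 0; doubling turns this 0 into a 1. *)
Lemma pdb_neighbours i : odd i -> pdb i.+1 || pdb i.-1.
Proof.
move=> oi; have [-> // | i1] := eqVneq i 1%N.
rewrite pdb_even ?(@pdb_even i.-1) //; try lia.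
rewrite -negb_and; apply/negP => /andP[].
have [ho|he] := boolP (odd i.+1./2); first by rewrite pdb_odd.
by move=> _; rewrite pdb_odd //; lia.
Qed.

(** The two odd summands add up to [(a.+1 + h).*2]: odd offsets from [a.*2.+1] are the doubled
    positions of the window at [a.+1]. *)
Lemma pdb_odd_add a h : pdb (a.*2.+1 + h.*2.+1) = ~~ pdb (a.+1 + h).
Proof. by rewrite -pdb_double ?addSn //; congr pdb; lia. Qed.

(** * Diagonal lines and their desubstitution *)

Lemma recplot1 i j : recplot i j = 1%N <-> pdb i = pdb j.
Proof. by rewrite /recplot !pdE; case: (pdb i); case: (pdb j). Qed.

Lemma recplot0 i j : recplot i j = 0%N <-> pdb i != pdb j.
Proof. by rewrite /recplot !pdE; case: (pdb i); case: (pdb j). Qed.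

Lemma diag_startE l i j : diag_start l i j <->
  [/\ (0 < i)%N, (0 < j)%N, (0 < l)%N,
      forall h, (h < l)%N -> pdb (i + h) = pdb (j + h) &
      pdb (i + l) != pdb (j + l) /\
      [|| i == 1%N, j == 1%N | pdb i.-1 != pdb j.-1]].
Proof.
split.
  move=> [[i0 j0 ij] l0 H /recplot0 H0 H1]; split => // [h /H /recplot1//|].
  split=> //; have [// | i1] := eqVneq i 1%N; have [// | j1] := eqVneq j 1%N.
  by rewrite /=; apply/recplot0/H1; lia.
move=> [i0 j0 l0 H [H0 H1]]; split => //.
- by split=> //; apply: contraNneq H0 => ->.
- by move=> h /H; rewrite recplot1.
- exact/recplot0.
- by move=> m; apply/recplot0; case/or3P: H1 => // /eqP e; lia.
Qed.

Lemma diag_start_sym l i j : diag_start l i j -> diag_start l j i.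
Proof.
move=> /diag_startE[i0 j0 l0 H [H0 H1]]; apply/diag_startE; split => // [h /H//|].
by rewrite eq_sym [pdb j.-1 == _]eq_sym orbCA.
Qed.

(** Even offsets compare odd positions, which all carry 0; odd offsets, and both ends, compare
    doubled positions, whose values are negated on both sides. Writing [2(i+1) - 1] as [i.*2.+1]
    avoids truncated subtraction. *)
Lemma diag_start_double m i j : (0 < m)%N ->
  diag_start m.*2.+1 i.*2.+1 j.*2.+1 <-> diag_start m i.+1 j.+1.
Proof.
move=> m0; rewrite !diag_startE.
have left_end : [|| i.*2.+1 == 1%N, j.*2.+1 == 1%N | pdb i.*2 != pdb j.*2] =
    [|| i.+1 == 1%N, j.+1 == 1%N | pdb i != pdb j].
  rewrite !eqSS !double_eq0; have [//|i0] := posnP i; have [//|j0] := posnP j.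
  by rewrite !pdb_double // (inj_eq (can_inj negbK)).
split=> -[i0 j0 l0 H [H0 H1]]; split => //.
- move=> h hm; apply: (can_inj negbK); rewrite -!pdb_odd_add.
  by apply: H; lia.
- split; last by rewrite -left_end.
  by apply: contraNneq H0; rewrite !pdb_odd_add => ->.
- move=> h hm; rewrite -[h]odd_double_half; case: (boolP (odd h)) => oh.
    by rewrite add1n !pdb_odd_add H //; lia.
  by rewrite !pdb_odd //; lia.
- by rewrite /= left_end !pdb_odd_add (inj_eq (can_inj negbK)).
Qed.

Lemma diag_start_not_even l i j : diag_start l i j -> odd i || odd j.
Proof.
move=> /diag_startE[i0 j0 _ _ [_ H]]; apply/negPn; rewrite negb_or.
apply/negP => /andP[ei ej]; case/or3P: H => [/eqP e|/eqP e|]; try lia.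
by rewrite !pdb_odd //; lia.
Qed.

(** For even [l] both end positions would be odd and carry 0, so no mismatch could occur there. *)
Lemma diag_start_odd_length l i j :
  diag_start l i j -> odd i -> odd j -> odd l.
Proof.
move=> /diag_startE[_ _ _ _ [H _]] oi oj; apply: contraNT H => el.
by rewrite !pdb_odd // oddD (negbTE el) addbF.
Qed.

(** Offsets 0 and 2 would transfer the zeros at the odd positions [i] and [i + 2] to the consecutive
    even positions [j] and [j + 2], against [pdb_neighbours]. *)
Lemma diag_start_mixed_length l i j :
  diag_start l i j -> odd i -> ~~ odd j -> (l <= 2)%N.
Proof.
move=> /diag_startE[i0 j0 l0 H _] oi ej; rewrite leqNgt; apply/negP => l3.
have := H 0%N (ltnW (ltnW l3)); have := H 2%N l3; rewrite !addn0.
rewrite !(@pdb_odd i) // !(@pdb_odd (i + 2)) ?oddD ?oi // => h2 h0.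
have := @pdb_neighbours j.+1; rewrite /= -addn2 -h2 -h0; lia.
Qed.

Lemma diag_start_long l i j : (2 < l)%N -> diag_start l i j ->
  [/\ odd l, odd i & odd j].
Proof.
move=> l2 D; have [oi|ei] := boolP (odd i); have [oj|ej] := boolP (odd j).
- by rewrite (diag_start_odd_length D).
- by have := diag_start_mixed_length D oi ej; lia.
- by have := diag_start_mixed_length (diag_start_sym D) oj ei; lia.
- by have := diag_start_not_even D; rewrite (negbTE ei) (negbTE ej).
Qed.

Lemma diag_start_double_inv m i j : (0 < m)%N -> diag_start m.*2.+1 i j ->
  exists i' j', [/\ i = i'.*2.+1, j = j'.*2.+1 & diag_start m i'.+1 j'.+1].
Proof.
move=> m0 D; have [|_ oi oj] := diag_start_long _ D; first lia.
exists i./2, j./2.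
have ei : i = i./2.*2.+1 by lia.
have ej : j = j./2.*2.+1 by lia.
by split=> //; apply/(diag_start_double _ _ m0); rewrite -ei -ej.
Qed.

(* On positive integers these are 2 M1 - 1, (2 M1 + 1) u {1}, 2 M1 and
   (4 M1 - 1) u (4 M1 + 1) u {1}; the index 1 enters the second one through
   [pdb 0 = false]. *)
Definition pre_double i := odd i && ~~ pdb i.+1.
Definition post_double i := odd i && ~~ pdb i.-1.
Definition doubled i := ~~ odd i && ~~ pdb i.
Definition between i := [&& odd i, pdb i.+1 & (i == 1%N) || pdb i.-1].

(** * Lines of length 1 and 2 *)

(** Two odd indices agree and must differ on both sides, so their neighbours read 1, 0 and 0, 1. In
    mixed parity the even index carries 0 between two zeros, and the neighbours of the odd one must
    carry 1 as far as they exist. *)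
Lemma diag_start1E i j : (0 < i)%N -> (0 < j)%N ->
  diag_start 1 i j <->
  [|| pre_double i && post_double j, post_double i && pre_double j,
      doubled i && between j | between i && doubled j].
Proof.
move=> i0 j0; rewrite diag_startE.
have -> : [/\ (0 < i)%N, (0 < j)%N, (0 < 1)%N,
      forall h, (h < 1)%N -> pdb (i + h) = pdb (j + h) &
      pdb (i + 1) != pdb (j + 1) /\
      [|| i == 1%N, j == 1%N | pdb i.-1 != pdb j.-1]] <->
   [&& pdb i == pdb j, pdb i.+1 != pdb j.+1 &
       [|| i == 1%N, j == 1%N | pdb i.-1 != pdb j.-1]].
  rewrite !addn1; split.
    by move=> [_ _ _ H [-> ->]]; have := H 0%N isT; rewrite !addn0 => ->; rewrite eqxx.
  move=> /and3P[/eqP H -> ->]; split=> // -[|// ] _; by rewrite !addn0.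
rewrite /pre_double /post_double /doubled /between.
(* [N] collects the local constraints on the values around one index; what remains is a finite check
   over truth values. *)
have N k : (0 < k)%N -> if odd k then [&& ~~ pdb k, pdb k.+1 || pdb k.-1 &
    (k == 1%N) ==> ~~ pdb k.-1] else [&& ~~ pdb k.+1, ~~ pdb k.-1 & k != 1%N].
  move=> k0; case: ifP => ok.
    by rewrite pdb_odd //= pdb_neighbours //=; apply/implyP => /eqP ->.
  by rewrite !pdb_odd /= ?ok //; lia.
have := N i i0; have := N j j0.
case: (odd i); case: (odd j); case: (pdb i); case: (pdb j); case: (pdb i.+1);
 case: (pdb j.+1); case: (pdb i.-1); case: (pdb j.-1); case: (i == _);
 case: (j == _) => //=.
Qed.

(** Even length forces mixed parity. Matching the odd successor of the even index puts a 0 after the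
    odd one; the mismatches at both ends then come from [pdb_neighbours]. *)
Lemma diag_start2E i j : (0 < i)%N -> (0 < j)%N ->
  diag_start 2 i j <->
  (pre_double i && doubled j) || (doubled i && pre_double j).
Proof.
move=> i0 j0; rewrite diag_startE.
have -> : [/\ (0 < i)%N, (0 < j)%N, (0 < 2)%N,
      forall h, (h < 2)%N -> pdb (i + h) = pdb (j + h) &
      pdb (i + 2) != pdb (j + 2) /\
      [|| i == 1%N, j == 1%N | pdb i.-1 != pdb j.-1]] <->
   [&& pdb i == pdb j, pdb i.+1 == pdb j.+1, pdb i.+2 != pdb j.+2 &
       [|| i == 1%N, j == 1%N | pdb i.-1 != pdb j.-1]].
  rewrite !addn2; split.
    move=> [_ _ _ H [-> ->]]; have := H 0%N isT; have := H 1%N isT.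
    by rewrite !addn0 !addn1 => -> ->; rewrite !eqxx.
  by move=> /and4P[/eqP H /eqP H' -> ->]; split=> // -[|[|// ]] _; rewrite ?addn0 ?addn1.
rewrite /pre_double /post_double /doubled /between.
have N k : (0 < k)%N -> if odd k then
    [&& ~~ pdb k, pdb k.+1 || pdb k.-1, ~~ pdb k.+2 & (k == 1%N) ==> ~~ pdb k.-1]
  else [&& ~~ pdb k.+1, ~~ pdb k.-1, pdb k.+2 || pdb k & k != 1%N].
  move=> k0; case: ifP => ok.
    rewrite (@pdb_odd k) // (@pdb_odd k.+2) /= ?negbK // pdb_neighbours //=.
    by apply/implyP => /eqP ->.
  rewrite (@pdb_odd k.+1) ?(@pdb_odd k.-1) /= ?ok //; last lia.
  by have := @pdb_neighbours k.+1; rewrite /= ok => -> //=; lia.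
have := N i i0; have := N j j0.
case: (odd i); case: (odd j); case: (pdb i); case: (pdb j); case: (pdb i.+1);
 case: (pdb j.+1); case: (pdb i.+2); case: (pdb j.+2);
 case: (pdb i.-1); case: (pdb j.-1); case: (i == _);
 case: (j == _) => //=.
Qed.

(** * The sets of the statement as conditions on parity and values *)

Lemma affine1P (a b : int) (S : set int) (y : int) :
  affine1 a b S y <-> exists2 x, S x & y = a * x + b.
Proof. by split=> [[x Sx <-]|[x Sx ->]]; exists x. Qed.

Lemma affine2P (a b : int) (S : set (int * int)) (p : int * int) :
  affine2 a b S p <->
  exists x y, [/\ S (x, y), p.1 = a * x + b & p.2 = a * y + b].
Proof.
split=> [[[x y] Sxy <-]|[x [y [Sxy]]]]; first by exists x, y.
by case: p => p1 p2 /= -> ->; exists (x, y).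
Qed.

Lemma affine_M1P (a b : int) (y : int) :
  affine1 a b M1 y <-> exists m : nat, [/\ (0 < m)%N, pdb m & y = a * m%:Z + b].
Proof.
rewrite affine1P; split.
  move=> [_ [m [m0 pm] <-] ->]; exists m; split=> //.
  by move: pm; rewrite pdE; case: (pdb m).
move=> [m [m0 pm ->]]; exists m%:Z => //; exists m => //.
by split=> //; rewrite pdE pm.
Qed.

Lemma in_pre_double (i : nat) : affine1 2 (-1) M1 i%:Z <-> pre_double i.
Proof.
rewrite affine_M1P /pre_double; split.
  move=> [m [m0 pm e]]; have -> : i = m.*2.-1 by lia.
  by rewrite prednK ?double_gt0 // pdb_double // pm andbT; lia.
move=> /andP[oi pi]; exists i./2.+1; split => //; last lia.
have e : i.+1 = i./2.+1.*2 by lia.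
by move: pi; rewrite e pdb_double // negbK.
Qed.

Lemma in_doubled (i : nat) : (0 < i)%N -> affine1 2 0 M1 i%:Z <-> doubled i.
Proof.
move=> i0; rewrite affine_M1P /doubled; split.
  move=> [m [m0 pm e]]; have -> : i = m.*2 by lia.
  by rewrite pdb_double // pm andbT odd_double.
move=> /andP[oi pi]; exists i./2; split; [lia| |lia].
by move: pi; rewrite pdb_even // negbK.
Qed.

Lemma in_post_double (i : nat) :
  affine1 2 1 M1 i%:Z <-> (i != 1%N) && post_double i.
Proof.
rewrite affine_M1P /post_double; split.
  move=> [m [m0 pm e]]; have -> : i = m.*2.+1 by lia.
  by rewrite eqSS /= pdb_double // pm odd_double double_eq0 -lt0n m0.
move=> /and3P[i1 oi pi]; exists i./2; split; [lia| |lia].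
have e : i.-1 = i./2.*2 by lia.
by move: pi; rewrite e pdb_double ?negbK //; lia.
Qed.

(** Of the two even neighbours of [i], one is twice an odd number and always carries 1; the other is
    [4m], which carries the value of [m]. *)
Lemma in_between (i : nat) :
  (affine1 4 (-1) M1 `|` affine1 4 1 M1) i%:Z <-> (i != 1%N) && between i.
Proof.
rewrite /setU /= !affine_M1P /between; split.
  case=> -[m [m0 pm e]].
    have -> : i = m.*2.*2.-1 by lia.
    have -> : m.*2.*2.-1.+1 = m.*2.*2 by lia.
    have -> : m.*2.*2.-1.-1 = m.*2.-1.*2 by lia.
    rewrite !pdb_double ?double_gt0 // ?pm; last lia.
    by rewrite (@pdb_odd m.*2.-1) ?orbT; lia.
  have -> : i = m.*2.*2.+1 by lia.
  have -> : m.*2.*2.+2 = m.*2.+1.*2 by lia.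
  rewrite !pdb_double ?double_gt0 //= ?odd_double //.
  by rewrite pm (@pdb_odd m.*2.+1) ?orbT /= ?odd_double //; lia.
move=> /and4P[i1 oi p1 p2]; move: p2; rewrite (negbTE i1) /= => p2.
have {}p1 : ~~ pdb i./2.+1.
  have e : i.+1 = i./2.+1.*2 by lia.
  by move: p1; rewrite e pdb_double.
have {}p2 : ~~ pdb i./2.
  have e : i.-1 = i./2.*2 by lia.
  by move: p2; rewrite e pdb_double //; lia.
(* The parity of [i./2] tells which neighbour is divisible by 4: [i.+1] in the first case, [i.-1] in
   the second. *)
have [ho|he] := boolP (odd i./2).
  left; exists (i./2.+1)./2; split; [lia| |lia].
  by rewrite -[pdb _]negbK -pdb_even //; lia.
right; exists (i./2)./2; split; [lia| |lia].
by rewrite -[pdb _]negbK -pdb_even //; lia.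
Qed.

Lemma affine2_1_0 (S : set (int * int)) : affine2 (2 ^+ 0) (- (2 ^+ 0 - 1)) S = S.
Proof.
apply/seteqP; split=> -[x y].
  move=> /affine2P [x' [y' [Sxy /= -> ->]]].
  by move: Sxy; congr S; congr pair; lia.
by move=> Sxy; apply/affine2P; exists x, y; split=> //=; lia.
Qed.

Lemma affine1_1_0 (S : set int) : affine1 (2 ^+ 0) (- (2 ^+ 0 - 1)) S = S.
Proof.
apply/seteqP; split=> x.
  by move=> /affine1P [x' Sx ->]; move: Sx; congr S; lia.
by move=> Sx; apply/affine1P; exists x => //; lia.
Qed.

Lemma case1_set0 (i j : nat) : (0 < i)%N -> (0 < j)%N ->
  case1_set 0 (i%:Z, j%:Z) <->
  pre_double i && post_double j || doubled i && between j.
Proof.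
move=> i0 j0; rewrite /case1_set affine2_1_0 affine1_1_0.
rewrite /A /A1 /A2 /B /setU /setX /=.
rewrite -/(setU _ _ j%:Z).
have H1 := in_pre_double i; have H2 := in_doubled i0.
have H3 := in_post_double j; have H4 := in_between j.
have j1 : j%:Z = 1 <-> j == 1%N by split => [|/eqP]; lia.
(* Index 1 satisfies [post_double] and [between] but is missing from the second factors of [A]; the
   product of [B] with [[set 1]] supplies exactly these pairs. *)
have post1 : j == 1%N -> post_double j by move=> /eqP ->.
have bet1 : j == 1%N -> between j by move=> /eqP ->.
change ((affine1 2 (-1) M1 i%:Z /\ affine1 2 1 M1 j%:Z \/
  affine1 2 0 M1 i%:Z /\ (affine1 4 (-1) M1 `|` affine1 4 1 M1) j%:Z) \/
  (affine1 2 (-1) M1 i%:Z \/ affine1 2 0 M1 i%:Z) /\ j%:Z = 1 <->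
  pre_double i && post_double j || doubled i && between j).
rewrite H1 H2 H3 H4 j1.
case: (j == 1%N) post1 bet1 => post1 bet1.
  rewrite post1 // bet1 //=.
  by case: (pre_double i); case: (doubled i) => /=; intuition.
rewrite /=.
by case: (pre_double i); case: (doubled i); case: (post_double j); case: (between j) => /=; intuition.
Qed.

Lemma case2_set0 (i j : nat) : (0 < i)%N -> (0 < j)%N ->
  case2_set 0 (i%:Z, j%:Z) <-> pre_double i && doubled j.
Proof.
move=> i0 j0; rewrite /case2_set affine2_1_0.
rewrite -(rwP andP) -in_pre_double -in_doubled //.
Qed.

(** * Scaling in [k] and the starting points of each length *)

(** The affine map is [s -> 2 ^ k * (s - 1) + 1], a scaling about 1. Raising [k] by one doubles the
    distance to 1, which is the reindexing of [diag_start_double]. *)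
Lemma affine2S k (S : set (int * int)) (x y : int) :
  affine2 (2 ^+ k.+1) (- (2 ^+ k.+1 - 1)) S (2 * x + 1, 2 * y + 1) <->
  affine2 (2 ^+ k) (- (2 ^+ k - 1)) S (x + 1, y + 1).
Proof.
rewrite !affine2P; split=> -[a [b [Sab /= h1 h2]]]; exists a, b; split => //=;
  move: h1 h2; rewrite exprS; lia.
Qed.

Lemma affine1S k (S : set int) (x : int) :
  affine1 (2 ^+ k.+1) (- (2 ^+ k.+1 - 1)) S (2 * x + 1) <->
  affine1 (2 ^+ k) (- (2 ^+ k - 1)) S (x + 1).
Proof.
rewrite !affine1P; split=> -[a Sa h]; exists a => //;
  move: h; rewrite exprS; lia.
Qed.

Lemma affine1S_odd k (S : set int) (i : nat) :
  affine1 (2 ^+ k.+1) (- (2 ^+ k.+1 - 1)) S i%:Z -> odd i.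
Proof. rewrite affine1P => -[a _]; rewrite exprS; lia. Qed.

Lemma affine2S_odd k (S : set (int * int)) (i j : nat) :
  affine2 (2 ^+ k.+1) (- (2 ^+ k.+1 - 1)) S (i%:Z, j%:Z) -> odd i && odd j.
Proof. rewrite affine2P => -[a [b [_ /=]]]; rewrite exprS; lia. Qed.

Lemma case1_setS k (i j : nat) :
  case1_set k.+1 (i.*2.+1%:Z, j.*2.+1%:Z) <-> case1_set k (i.+1%:Z, j.+1%:Z).
Proof.
have D (n : nat) : n.*2.+1%:Z = 2 * n%:Z + 1 by lia.
have I (n : nat) : n.+1%:Z = n%:Z + 1 by lia.
rewrite /case1_set /setU /setX /set1 /= !D !I affine2S affine1S.
by have -> : (2 * j%:Z + 1 = 1) = (j%:Z + 1 = 1) by apply/propext; split; lia.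
Qed.

Lemma case2_setS k (i j : nat) :
  case2_set k.+1 (i.*2.+1%:Z, j.*2.+1%:Z) <-> case2_set k (i.+1%:Z, j.+1%:Z).
Proof.
have D (n : nat) : n.*2.+1%:Z = 2 * n%:Z + 1 by lia.
have I (n : nat) : n.+1%:Z = n%:Z + 1 by lia.
by rewrite /case2_set !D !I affine2S.
Qed.

Lemma case1_setS_odd k (i j : nat) :
  case1_set k.+1 (i%:Z, j%:Z) -> odd i && odd j.
Proof. by case=> [/affine2S_odd//|[/= /affine1S_odd -> [->]]]. Qed.

(** Induction on [k] from length 1: for two odd indices both sides desubstitute, and otherwise both
    sides fail. *)
Lemma diag_start_case1 k (i j : nat) : (0 < i)%N -> (0 < j)%N ->
  diag_start (2 ^ k.+1 - 1) i j <->
  case1_set k (i%:Z, j%:Z) \/ case1_set k (j%:Z, i%:Z).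
Proof.
elim: k i j => [|k IH] i j i0 j0.
  rewrite (diag_start1E i0 j0) !case1_set0 //.
  case: (pre_double i); case: (post_double i); case: (doubled i);
  case: (between i); case: (pre_double j); case: (post_double j);
  case: (doubled j); case: (between j) => /=; intuition.
have l0 : (0 < 2 ^ k.+1 - 1)%N by rewrite subn_gt0 -[1%N](expn0 2) ltn_exp2l.
have -> : (2 ^ k.+2 - 1 = (2 ^ k.+1 - 1).*2.+1)%N.
  by rewrite [(2 ^ k.+2)%N]expnS; lia.
have [/andP[oi oj]|no] := boolP (odd i && odd j).
  have -> : i = i./2.*2.+1 by lia.
  have -> : j = j./2.*2.+1 by lia.
  by rewrite diag_start_double // !case1_setS IH.
split=> [/(diag_start_long _)[]|]; first lia.
  by move=> _ oi oj; rewrite oi oj in no.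
by case=> /case1_setS_odd h; case/negP: no => //; rewrite andbC.
Qed.

Lemma diag_start_case2 k (i j : nat) : (0 < i)%N -> (0 < j)%N ->
  diag_start (3 * 2 ^ k - 1) i j <->
  case2_set k (i%:Z, j%:Z) \/ case2_set k (j%:Z, i%:Z).
Proof.
elim: k i j => [|k IH] i j i0 j0.
  rewrite (diag_start2E i0 j0) !case2_set0 //.
  case: (pre_double i); case: (doubled i);
  case: (pre_double j); case: (doubled j) => /=; intuition.
have l0 : (0 < 2 ^ k)%N by rewrite expn_gt0.
have -> : (3 * 2 ^ k.+1 - 1 = (3 * 2 ^ k - 1).*2.+1)%N.
  by rewrite [(2 ^ k.+1)%N]expnS; lia.
have [/andP[oi oj]|no] := boolP (odd i && odd j).
  have -> : i = i./2.*2.+1 by lia.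
  have -> : j = j./2.*2.+1 by lia.
  by rewrite diag_start_double ?case2_setS ?IH //; lia.
split=> [/(diag_start_long _)[]|]; first lia.
  by move=> _ oi oj; rewrite oi oj in no.
by case=> /affine2S_odd h; case/negP: no => //; rewrite andbC.
Qed.

(** * Admissible lengths *)

Definition length1 l := exists k, l = (2 ^ k.+1 - 1)%N.
Definition length2 l := exists k, l = (3 * 2 ^ k - 1)%N.

(** The map [m -> 2m + 1] doubles [l + 1]. The value [m = 0] must be excluded, since 1 is of this
    form and 0 is not. *)
Lemma length1_double m : (0 < m)%N -> length1 m.*2.+1 <-> length1 m.
Proof.
move=> m0; split=> [[[|k] e]|[k ->]].
- by move: e; rewrite expn1; lia.
- by exists k; move: e; rewrite [(2 ^ k.+2)%N]expnS; lia.
- by exists k.+1; have := expn_gt0 2 k.+1; rewrite [(2 ^ k.+2)%N]expnS; lia.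
Qed.

Lemma length2_double m : length2 m.*2.+1 <-> length2 m.
Proof.
split=> [[[|k] e]|[k ->]].
- by move: e; rewrite expn0; lia.
- by exists k; move: e; rewrite expnS; lia.
- by exists k.+1; have := expn_gt0 2 k; rewrite [(2 ^ k.+1)%N]expnS; lia.
Qed.

(** Otherwise 3 would divide a power of 2. This makes the two cases of the theorem exclusive. *)
Lemma length12 l : ~ (length1 l /\ length2 l).
Proof.
move=> [[k ->] [k' e]].
have {}e : (2 ^ k.+1 = 3 * 2 ^ k')%N.
  by have := expn_gt0 2 k.+1; have := expn_gt0 2 k'; lia.
have : (3 %| 2 ^ k.+1)%N by rewrite e dvdn_mulr.
by rewrite Euclid_dvdX.
Qed.

Lemma length12_even l : (2 < l)%N -> ~~ odd l -> ~ length1 l /\ ~ length2 l.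
Proof.
move=> l2 el; split=> -[[|k] e]; move: e; rewrite ?expn0 ?expn1 ?expnS; lia.
Qed.

Lemma diag_start_length l i j : diag_start l i j -> length1 l \/ length2 l.
Proof.
elim/ltn_ind: l i j => l IH i j D.
have [l2|l2] := ltnP 2 l.
  have [ol _ _] := diag_start_long l2 D.
  have el : l = l./2.*2.+1 by lia.
  have m0 : (0 < l./2)%N by lia.
  rewrite el in D; have [i' [j' [_ _ D']]] := diag_start_double_inv m0 D.
  rewrite el (length1_double m0) length2_double.
  by apply: (IH _ _ _ _ D'); lia.
have /diag_startE[_ _ l0 _ _] := D.
have [->|->] : l = 1%N \/ l = 2%N by lia.
  by left; exists 0%N.
by right; exists 0%N.
Qed.

Lemma diag_start_cases l i j : (0 < i)%N -> (0 < j)%N ->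
  diag_start l i j <-> case1 l i j \/ case2 l i j.
Proof.
move=> i0 j0; split.
  move=> D; case: (diag_start_length D) => -[k e]; [left|right]; exists k;
    split=> //; rewrite e in D; [exact/diag_start_case1|exact/diag_start_case2].
by case=> -[k [-> H]]; [exact/diag_start_case1|exact/diag_start_case2].
Qed.

(** * Determining words *)

Lemma pd_word_eq i j l :
  (forall h, (h < l)%N -> pdb (i + h) = pdb (j + h)) -> pd_word i l = pd_word j l.
Proof.
move=> H; apply/eq_in_map => h; rewrite mem_iota add0n => /andP[_ hl].
by rewrite !pdE H.
Qed.

Lemma determined_byP l i j r : diag_start l i j ->
  (forall h, (h < l)%N -> pdb (i + h) = pdb (r + h)) ->
  determined_by (pd_word r l) l i j.
Proof.
move=> /diag_startE[_ _ _ H _] Hr.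
by split; apply: pd_word_eq => h hl; rewrite -?H ?Hr.
Qed.

Lemma word_double i r m :
  (forall h, (h < m)%N -> pdb (i.+1 + h) = pdb (r.+1 + h)) ->
  forall h, (h < m.*2.+1)%N -> pdb (i.*2.+1 + h) = pdb (r.*2.+1 + h).
Proof.
move=> H h hm; rewrite -[h]odd_double_half; case: (boolP (odd h)) => oh.
  by rewrite add1n !pdb_odd_add H //; lia.
by rewrite !pdb_odd //; lia.
Qed.

(** Position 1 is fixed by [n -> 2n - 1], so the prefix survives every substitution step. For length
    1 one of the two indices is odd, hence the common letter is 0. *)
Lemma diag_start_word1 k i j : diag_start (2 ^ k.+1 - 1) i j ->
  forall h, (h < 2 ^ k.+1 - 1)%N -> pdb (i + h) = pdb (1 + h).
Proof.
elim: k i j => [|k IH] i j D.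
  move=> [|//] _; rewrite !addn0.
  have /diag_startE[i0 j0 _ H _] := D.
  have [oi|ei] := boolP (odd i); first by rewrite !pdb_odd.
  have := H 0%N isT; rewrite !addn0 => ->.
  have := diag_start_not_even D; rewrite (negbTE ei) /= => oj.
  by rewrite !pdb_odd.
have l0 : (0 < 2 ^ k.+1 - 1)%N by rewrite subn_gt0 -[1%N](expn0 2) ltn_exp2l.
have e : (2 ^ k.+2 - 1 = (2 ^ k.+1 - 1).*2.+1)%N.
  by rewrite [(2 ^ k.+2)%N]expnS; lia.
rewrite e in D *; have [i' [j' [-> _ D']]] := diag_start_double_inv l0 D.
exact: (word_double (r := 0) (IH _ _ D')).
Qed.

(** For length 2 the word is 00, which occurs at position 3; applying [n -> 2n - 1] to 3 [k] times
    gives [2 ^ k.+1 + 1]. *)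
Lemma diag_start_word2 k i j : diag_start (3 * 2 ^ k - 1) i j ->
  forall h, (h < 3 * 2 ^ k - 1)%N -> pdb (i + h) = pdb (2 ^ k.+1 + 1 + h).
Proof.
elim: k i j => [|k IH] i j D.
  have /diag_startE[i0 j0 _ H _] := D.
  move/(diag_start2E i0 j0): D; rewrite /pre_double /doubled.
  case/orP => /andP[/andP[oi pi] /andP[oj pj]] [|[|//]] _; rewrite ?addn0 ?addn1.
  - by rewrite !pdb_odd.
  - by rewrite (negbTE pi).
  - by rewrite (negbTE pi).
  - by rewrite pdb_odd //= oi.
have l0 : (0 < 2 ^ k)%N by rewrite expn_gt0.
have e : (3 * 2 ^ k.+1 - 1 = (3 * 2 ^ k - 1).*2.+1)%N.
  by rewrite [(2 ^ k.+1)%N]expnS; lia.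
rewrite e in D *; have [|i' [j' [-> _ D']]] := diag_start_double_inv _ D; first lia.
have -> : (2 ^ k.+2 + 1 = (2 ^ k.+1).*2.+1)%N by rewrite [(2 ^ k.+2)%N]expnS; lia.
apply: word_double => h hl; rewrite (IH _ _ D') //; congr pdb; lia.
Qed.

(** * Counting starting points in a square *)

Definition count1 (P : pred nat) (n : nat) : nat := (\sum_(i < n) P i.+1)%N.

Lemma count_uptoE (S : set (nat * nat)) n :
  count_upto S n = (\sum_(i < n) \sum_(j < n) ((i.+1, j.+1) \in S))%N.
Proof.
rewrite /count_upto pair_big -sum1_card big_mkcond /=.
by apply: eq_bigr => p _; rewrite inE; case: (_ \in S).
Qed.

Lemma sum_even_support n (F : nat -> nat) : (forall i, odd i -> F i = 0%N) ->
  (\sum_(i < n) F i = \sum_(i < uphalf n) F i.*2)%N.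
Proof.
move=> F0; elim: n => [|n IH]; first by rewrite !big_ord0.
rewrite big_ord_recr /= IH; have [ho|he] := boolP (odd n).
  have -> : n./2.+1 = uphalf n by rewrite uphalf_half; lia.
  by rewrite F0 // addn0.
have -> : n./2.+1 = (uphalf n).+1 by rewrite uphalf_half; lia.
rewrite big_ord_recr /= (_ : (uphalf n).*2 = n) //.
by rewrite uphalf_half; lia.
Qed.

(** The summation index [i] stands for the integer [i.+1], so odd starting points sit at even [i],
    and there are [uphalf n] such [i] below [n]. *)
Lemma count_upto_double m n : (0 < m)%N ->
  count_upto [set p | diag_start m.*2.+1 p.1 p.2] n =
  count_upto [set p | diag_start m p.1 p.2] (uphalf n).
Proof.
move=> m0; have notin i j : odd i || odd j ->
    (i.+1, j.+1) \in [set p | diag_start m.*2.+1 p.1 p.2] = false.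
  move=> o; apply/negbTE; rewrite notin_setE /= => /diag_start_long[]; lia.
rewrite !count_uptoE (@sum_even_support n (fun i => \sum_(j < n)
  ((i.+1, j.+1) \in [set p | diag_start m.*2.+1 p.1 p.2]))%N); last first.
  by move=> i oi; rewrite big1 // => j _; rewrite notin ?oi.
apply: eq_bigr => i _.
rewrite (@sum_even_support n (fun j =>
  nat_of_bool ((i.*2.+1, j.+1) \in [set p | diag_start m.*2.+1 p.1 p.2]))).
  by apply: eq_bigr => j _; congr (nat_of_bool _); apply/idP/idP;
    rewrite !inE /= diag_start_double.
by move=> j oj; rewrite notin ?oj ?orbT.
Qed.

Lemma count_upto1 n : count_upto [set p | diag_start 1 p.1 p.2] n =
  (2 * (count1 pre_double n * count1 post_double n
        + count1 doubled n * count1 between n))%N.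
Proof.
rewrite count_uptoE.
transitivity (\sum_(i < n) \sum_(j < n) (
   pre_double i.+1 * post_double j.+1 + post_double i.+1 * pre_double j.+1
   + (doubled i.+1 * between j.+1 + between i.+1 * doubled j.+1)))%N.
  apply: eq_bigr => i _; apply: eq_bigr => j _.
  have -> : (i.+1, j.+1) \in [set p | diag_start 1 p.1 p.2] =
    [|| pre_double i.+1 && post_double j.+1, post_double i.+1 && pre_double j.+1,
      doubled i.+1 && between j.+1 | between i.+1 && doubled j.+1].
    by apply/idP/idP; rewrite inE /= (diag_start1E (ltn0Sn i) (ltn0Sn j)).
  (* These exclusions make the four disjuncts pairwise incompatible, so the disjunction becomes a
     sum. [post_double] and [between] do share index 1, but there their partners [pre_double] and
     [doubled] exclude each other. *)
  have X k : (0 < k)%N -> [&& ~~ (pre_double k && post_double k),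
      ~~ (doubled k && between k), ~~ (pre_double k && doubled k),
      ~~ (pre_double k && between k) & ~~ (post_double k && doubled k)].
    move=> k0; have := @pdb_neighbours k.
    rewrite /pre_double /post_double /doubled /between.
    by case: (odd k) => /= [/(_ isT)|_]; case: (pdb k.+1); case: (pdb k.-1); 
      case: (pdb k) => //=; rewrite ?orbT ?andbF.
  have := X i.+1 isT; have := X j.+1 isT.
  case: (pre_double i.+1); case: (post_double i.+1); case: (doubled i.+1);
  case: (between i.+1); case: (pre_double j.+1); case: (post_double j.+1);
  case: (doubled j.+1); case: (between j.+1) => //=.
under eq_bigr do rewrite !big_split /=.
rewrite !big_split /= /count1 -!big_distrlr /=; lia.
Qed.

Lemma count_upto2 n : count_upto [set p | diag_start 2 p.1 p.2] n =
  (2 * (count1 pre_double n * count1 doubled n))%N.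
Proof.
rewrite count_uptoE.
transitivity (\sum_(i < n) \sum_(j < n) (
   pre_double i.+1 * doubled j.+1 + doubled i.+1 * pre_double j.+1))%N.
  apply: eq_bigr => i _; apply: eq_bigr => j _.
  have -> : (i.+1, j.+1) \in [set p | diag_start 2 p.1 p.2] =
    (pre_double i.+1 && doubled j.+1) || (doubled i.+1 && pre_double j.+1).
    by apply/idP/idP; rewrite inE /= (diag_start2E (ltn0Sn i) (ltn0Sn j)).
  rewrite /pre_double /doubled.
  by case: (odd i.+1); case: (odd j.+1); case: (pdb i.+2); case: (pdb i.+1);
    case: (pdb j.+2); case: (pdb j.+1).
under eq_bigr do rewrite !big_split /=.
rewrite !big_split /= /count1 -!big_distrlr /=; lia.
Qed.

Lemma count_upto_even l n : (2 < l)%N -> ~~ odd l ->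
  count_upto [set p | diag_start l p.1 p.2] n = 0%N.
Proof.
move=> l2 el; rewrite count_uptoE big1 // => i _; rewrite big1 // => j _.
suff -> : (i.+1, j.+1) \in [set p | diag_start l p.1 p.2] = false by [].
by apply/negbTE; rewrite notin_setE /= => /(diag_start_long l2)[ol]; rewrite ol in el.
Qed.

(** * Counting the four classes of indices *)

Lemma count1_even n : count1 (fun i => ~~ odd i) n = n./2.
Proof.
rewrite /count1; elim: n => [|n IH]; first by rewrite big_ord0.
by rewrite big_ord_recr /= IH; lia.
Qed.

Lemma count1_odd n : count1 odd n = uphalf n.
Proof.
rewrite /count1; elim: n => [|n IH]; first by rewrite big_ord0.
by rewrite big_ord_recr /= IH uphalf_half; lia.
Qed.

Lemma count1_doubled_pdb n : (count1 doubled n + count1 pdb n = n./2)%N.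
Proof.
rewrite -count1_even /count1 -big_split /=; apply: eq_bigr => i _.
rewrite /doubled /=; have := @pdb_odd i.+1; rewrite /=.
by case: (odd i) => //= [_|->//]; case: (pdb i.+1).
Qed.

(** The ones up to [n] sit at the doubles of the zeros up to [n./2]. *)
Lemma count1_pdb_half n : (count1 pdb n + count1 pdb n./2 = n./2)%N.
Proof.
elim: n => [|n IH]; first by rewrite /count1 !big_ord0.
have [ho|he] := boolP (odd n).
  have e : n.+1./2 = n./2.+1 by lia.
  rewrite e /count1 !big_ord_recr /= -!/(count1 pdb _).
  have -> : pdb n.+1 = ~~ pdb n./2.+1 by rewrite -pdb_double //; congr pdb; lia.
  by move: IH; rewrite /count1; case: (pdb n./2.+1) => /=; lia.
have -> : n.+1./2 = n./2 by lia.
by rewrite /count1 big_ord_recr /= pdb_odd ?addn0 //= he.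
Qed.

(** [pre_double i] is [doubled i.+1], so the counts differ by one boundary term of a shift. *)
Lemma count1_pre_double n :
  (count1 doubled n <= count1 pre_double n <= (count1 doubled n).+1)%N.
Proof.
have : (count1 pre_double n = count1 doubled n + doubled n.+1)%N.
  elim: n => [|n IH]; first by rewrite /count1 !big_ord0.
  rewrite /count1 !big_ord_recr /= -!/(count1 _ _) IH; congr addn; rewrite /pre_double /doubled /=.
  by rewrite !negbK.
by case: (doubled n.+1); lia.
Qed.

(** For positive [i], [post_double i] is [doubled i.-1]; the default [doubled 0], which is true,
    accounts for index 1 and for the successor on the right. *)
Lemma count1_post_double n :
  (count1 doubled n <= count1 post_double n <= (count1 doubled n).+1)%N.
Proof.
have : (count1 post_double n + doubled n = (count1 doubled n).+1)%N.
  elim: n => [|n IH]; first by rewrite /count1 !big_ord0.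
  by rewrite /count1 !big_ord_recr /= -!/(count1 _ _) -addSn -IH -!addnA; congr addn.
by case: (doubled n); lia.
Qed.

(* The three classes partition the odd numbers, except that 1 is counted twice. *)
Lemma count1_between n :
  (count1 pre_double n + count1 post_double n + count1 between n
   = uphalf n + (0 < n))%N.
Proof.
rewrite -count1_odd; elim: n => [|n IH]; first by rewrite /count1 !big_ord0.
have step : (pre_double n.+1 + post_double n.+1 + between n.+1 + (0 < n) =
    odd n.+1 + 1)%N.
  case: n {IH} => // n; rewrite /pre_double /post_double /between.
  have := @pdb_neighbours n.+2.
  by case: (odd n.+2) => //= /(_ isT); case: (pdb n.+3); case: (pdb n.+1).
move: IH; rewrite /count1 !big_ord_recr /=; lia.
Qed.

(** * Discrepancy bounds and limiting frequencies *)

Lemma natr_half (R : realType) n : (n%:R : R) = 2 * n./2%:R + (odd n)%:R.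
Proof. by rewrite -{1}(odd_double_half n) natrD -mul2n natrM addrC. Qed.

Lemma bool_natr_ge0_le1 (R : realType) (b : bool) : 0 <= (b%:R : R) <= 1.
Proof. by case: b; rewrite lexx ler01. Qed.

(* [e n = 3 * count1 pdb n - n] satisfies [e n = - e n./2 - odd n], so it is in
   fact logarithmic; a square root bound is enough and easier to propagate. *)
Lemma count1_pdb_discrepancy (R : realType) n :
  (3 * (count1 pdb n)%:R - n%:R) ^+ 2 <= 9 * n%:R :> R.
Proof.
elim/ltn_ind: n => n IH.
have [n1|n1] := leqP n 1.
  have -> : count1 pdb n = 0%N.
    by case: n n1 {IH} => [|[|//]] _; rewrite /count1 ?big_ord_recl ?big_ord0.
  by case: n n1 {IH} => [|[|//]] _; lra.
have q1 : 1 <= (n./2%:R : R) by rewrite ler1n; lia.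
have := IH n./2 ltac:(lia); have := natr_half R n.
have := bool_natr_ge0_le1 R (odd n).
have := congr1 (fun k => k%:R : R) (count1_pdb_half n); rewrite /= natrD.
set f := (count1 pdb n)%:R; set g := (count1 pdb n./2)%:R.
set q := (n./2)%:R in q1 *; set b := (odd n)%:R => hf /andP[b0 b1] -> h.
have -> : f = q - g by rewrite -hf addrK.
set e := 3 * g - q in h.
have -> : 3 * (q - g) - (2 * q + b) = - (e + b) by rewrite /e; lra.
rewrite sqrrN; have b2 : b ^+ 2 <= 1 by rewrite exprn_ile1.
(* The square yields [2eb <= e^2/3 + 3b^2], hence [(e + b)^2 <= 12q + 4 <= 18q], the last step
   because [q >= 1]. *)
by have := sqr_ge0 (e - 3 * b); lra.
Qed.

(** Dividing by [n^2] bounds the squared error by [M / n]; the squared form avoids square roots. *)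
Lemma cvg_ratio (R : realType) (u : nat -> R) (d M : R) :
  (forall n, (0 < n)%N -> (u n - d * n%:R) ^+ 2 <= M * n%:R) ->
  (fun n => u n / n%:R) @ \oo --> d.
Proof.
move=> H; apply/cvgrPdist_lt => e e0; near=> n.
have n0 : (0 < n)%N by near: n; exact: nbhs_infty_gt.
have n0R : 0 < n%:R :> R by rewrite ltr0n.
have Mn : M / e ^+ 2 < n%:R by near: n; exact: nbhs_infty_gtr.
have -> : d - u n / n%:R = - (u n - d * n%:R) / n%:R.
  by field; rewrite gt_eqF.
rewrite normrM normrN normfV (gtr0_norm n0R) ltr_pdivrMr //.
rewrite -(@ltr_pXn2r _ 2) ?nnegrE // ?mulr_ge0 ?(ltW e0) //.
rewrite real_normK ?num_real // exprMn.
apply: (le_lt_trans (H n n0)).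
by rewrite [n%:R ^+ 2]expr2 mulrA ltr_pM2r // mulrC -ltr_pdivrMr // exprn_gt0.
Unshelve. all: by end_near. Qed.

Lemma cvg_uphalf (R : realType) :
  (fun n => (uphalf n)%:R / n%:R : R) @ \oo --> (1 / 2 : R).
Proof.
apply: (@cvg_ratio _ _ _ 1) => n n0.
have := natr_half R n; rewrite uphalf_half natrD.
have : 1 <= (n%:R : R) by rewrite ler1n.
by case: (odd n) => /=; nra.
Qed.

(** One criterion serves all four classes; the factor 4 is dictated by [between], whose error is
    about twice that of [doubled]. With [a^2 <= 9n] one gets [(4a + 30)^2 / 36 <= 58n], within the
    bound 100. *)
Lemma cvg_count1 (R : realType) (P : pred nat) :
  (forall n, `|6 * (count1 P n)%:R - n%:R| <=
             4 * `|3 * (count1 pdb n)%:R - n%:R| + 30 :> R) ->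
  (fun n => (count1 P n)%:R / n%:R : R) @ \oo --> (1 / 6 : R).
Proof.
move=> H; apply: (@cvg_ratio _ _ _ 100) => n n0.
have n1 : 1 <= (n%:R : R) by rewrite ler1n.
have := count1_pdb_discrepancy R n; have := H n.
rewrite -[(3 * _ - _) ^+ 2]real_normK ?num_real //.
set a := `|3 * _ - _|; have : 0 <= a by exact: normr_ge0.
rewrite ler_norml => a0 /andP[h1 h2] h3.
set x := (count1 P n)%:R in h1 h2 *.
set y := 6 * x - n%:R in h1 h2.
have -> : x - 1 / 6 * n%:R = y / 6 by rewrite /y; lra.
have hy : y ^+ 2 <= (4 * a + 30) ^+ 2 by nra.
nra.
Qed.

(** With [e] the discrepancy of [pdb], the left side is the absolute value of [-2e - 3b], where [b]
    is the parity of [n]. *)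
Lemma count1_doubled_discrepancy (R : realType) n :
  `|6 * (count1 doubled n)%:R - n%:R| <=
    2 * `|3 * (count1 pdb n)%:R - n%:R| + 3 :> R.
Proof.
have := congr1 (fun k => k%:R : R) (count1_doubled_pdb n); rewrite /= natrD.
have := natr_half R n; have /andP[] := bool_natr_ge0_le1 R (odd n).
set e := 3 * _ - _; have := ler_norm e; have := ler_norm (- e).
by rewrite normrN ler_norml /e; lra.
Qed.

Lemma cvg_doubled (R : realType) :
  (fun n => (count1 doubled n)%:R / n%:R : R) @ \oo --> (1 / 6 : R).
Proof.
apply: cvg_count1 => n; apply: le_trans (count1_doubled_discrepancy R n) _.
by have := normr_ge0 (3 * (count1 pdb n)%:R - n%:R : R); lra.
Qed.

Lemma cvg_near_doubled (R : realType) (P : pred nat) :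
  (forall n, count1 doubled n <= count1 P n <= (count1 doubled n).+1)%N ->
  (fun n => (count1 P n)%:R / n%:R : R) @ \oo --> (1 / 6 : R).
Proof.
move=> H; apply: cvg_count1 => n; have := count1_doubled_discrepancy R n.
have := normr_ge0 (3 * (count1 pdb n)%:R - n%:R : R).
have /andP[] := H n; rewrite -!(ler_nat R) -[(count1 doubled n).+1%:R]natr1 !ler_norml.
by move=> hl hu a0 /andP[h1 h2]; lra.
Qed.

Lemma cvg_between (R : realType) :
  (fun n => (count1 between n)%:R / n%:R : R) @ \oo --> (1 / 6 : R).
Proof.
apply: cvg_count1 => n; have := count1_doubled_discrepancy R n.
have := normr_ge0 (3 * (count1 pdb n)%:R - n%:R : R).
have := congr1 (fun k => k%:R : R) (count1_between n).
rewrite uphalf_half /= !natrD => hb.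
have /andP[] := count1_pre_double n; have /andP[] := count1_post_double n.
rewrite -!(ler_nat R) -[(count1 doubled n).+1%:R]natr1.
have /andP[] := bool_natr_ge0_le1 R (0 < n)%N.
have := natr_half R n; have /andP[] := bool_natr_ge0_le1 R (odd n).
rewrite !ler_norml => b0 b1 hn c0 c1 l1 u1 l2 u2 a0 /andP[h1 h2].
by lra.
Qed.

(** * Densities of the sets of starting points *)

Definition diag_starts l : set (nat * nat) := [set p | diag_start l p.1 p.2].

Lemma has_density1 (R : realType) : has_density (diag_starts 1) (1 / 9 : R).
Proof.
rewrite /has_density.
under eq_fun do rewrite count_upto1.
have -> : (1 / 9 : R) = 2 * (1 / 6 * (1 / 6) + 1 / 6 * (1 / 6)) by lra.
rewrite (_ : (fun _ => _) = fun n : nat => 2 *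
  ((count1 pre_double n)%:R / n%:R * ((count1 post_double n)%:R / n%:R) +
   (count1 doubled n)%:R / n%:R * ((count1 between n)%:R / n%:R)) : R).
  apply: cvgM; first exact: cvg_cst.
  apply: cvgD; apply: cvgM.
  - exact: cvg_near_doubled count1_pre_double.
  - exact: cvg_near_doubled count1_post_double.
  - exact: cvg_doubled.
  - exact: cvg_between.
(* Only the inverse of [n] enters, as a formal factor, so the identity also covers [n = 0]. *)
by apply/funext => n; rewrite natrM natrD !natrM -exprVn; ring.
Qed.

Lemma has_density2 (R : realType) : has_density (diag_starts 2) (1 / 18 : R).
Proof.
rewrite /has_density.
under eq_fun do rewrite count_upto2.
have -> : (1 / 18 : R) = 2 * (1 / 6 * (1 / 6)) by lra.
rewrite (_ : (fun _ => _) = fun n : nat => 2 *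
  ((count1 pre_double n)%:R / n%:R * ((count1 doubled n)%:R / n%:R)) : R).
  apply: cvgM; first exact: cvg_cst.
  apply: cvgM; last exact: cvg_doubled.
  exact: cvg_near_doubled count1_pre_double.
by apply/funext => n; rewrite !natrM -exprVn; ring.
Qed.

Lemma has_density_even (R : realType) l : (2 < l)%N -> ~~ odd l ->
  has_density (diag_starts l) (0 : R).
Proof.
move=> l2 el; rewrite /has_density.
under eq_fun do rewrite count_upto_even // mul0r.
exact: cvg_cst.
Qed.

Lemma uphalf_cvg_infty : uphalf n @[n --> \oo] --> \oo.
Proof.
move=> A [N _ NA]; exists N.*2 => // n /= Nn.
by apply: NA => /=; rewrite uphalf_half; lia.
Qed.

Lemma has_density_double (R : realType) m (d : R) : (0 < m)%N ->
  has_density (diag_starts m) d -> has_density (diag_starts m.*2.+1) (d / 4).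
Proof.
rewrite /has_density => m0 H.
under eq_fun do rewrite count_upto_double //.
have -> : d / 4 = d * (1 / 2 * (1 / 2)) by lra.
rewrite (_ : (fun _ => _) = fun n : nat =>
  (count_upto (diag_starts m) (uphalf n))%:R / (uphalf n)%:R ^+ 2 *
  ((uphalf n)%:R / n%:R * ((uphalf n)%:R / n%:R)) : R).
  apply: cvgM; first exact: (cvg_comp _ _ uphalf_cvg_infty H).
  by apply: cvgM; exact: cvg_uphalf.
(* At [n = 0] both sides vanish by the convention that 0 has inverse 0. *)
apply/funext => -[|n]; first by rewrite /= expr0n /= invr0 !mulr0.
have u0 : (uphalf n.+1)%:R != 0 :> R by rewrite pnatr_eq0.
have v0 : n.+1%:R != 0 :> R by rewrite pnatr_eq0.
by move: (_%:R) u0 (n.+1%:R) v0 => u u0 v v0; field; rewrite u0 v0.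
Qed.

Lemma density_const1 (R : realType) l : length1 l -> density_const R l = 4 / 9.
Proof. by move=> H; rewrite /density_const asboolT. Qed.

Lemma density_const2 (R : realType) l : length2 l -> density_const R l = 1 / 2.
Proof.
move=> H; rewrite /density_const asboolF ?asboolT //.
by move=> H1; case: (@length12 l).
Qed.

Lemma density_const0 (R : realType) l :
  ~ length1 l -> ~ length2 l -> density_const R l = 0.
Proof. by move=> H1 H2; rewrite /density_const !asboolF. Qed.

Lemma density_const_double (R : realType) m : (0 < m)%N ->
  density_const R m.*2.+1 = density_const R m.
Proof.
move=> m0; rewrite /density_const.
by rewrite (asbool_equiv_eq (length1_double m0)) (asbool_equiv_eq (length2_double m)).
Qed.

(** Passing from [m] to [2m + 1] preserves the constant and doubles [l + 1], which matches the
    factor 1/4 of [has_density_double]. *)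
Lemma has_density_diag_starts (R : realType) l : (0 < l)%N ->
  has_density (diag_starts l) (density_const R l / (l%:R + 1) ^+ 2).
Proof.
elim/ltn_ind: l => l IH l0; have [l2|l2] := ltnP 2 l; last first.
  have [->|->] : l = 1%N \/ l = 2%N by lia.
    rewrite density_const1; last by exists 0%N.
    have -> : 4 / 9 / (1 + 1) ^+ 2 = 1 / 9 :> R by field.
    exact: has_density1.
  rewrite density_const2; last by exists 0%N.
  have -> : 1 / 2 / (2 + 1) ^+ 2 = 1 / 18 :> R by field.
  exact: has_density2.
have [ol|el] := boolP (odd l); last first.
  have [n1 n2] := length12_even l2 el; rewrite density_const0 // mul0r.
  exact: has_density_even.
have m0 : (0 < l./2)%N by lia.
have -> : l = l./2.*2.+1 by lia.
rewrite density_const_double //.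
have -> : density_const R l./2 / (l./2.*2.+1%:R + 1) ^+ 2 =
   density_const R l./2 / (l./2%:R + 1) ^+ 2 / 4.
  rewrite -[(l./2.*2.+1)%:R]natr1 -mul2n natrM; field.
  have h : 0 <= l./2%:R :> R by [].
  by rewrite gt_eqF /=; lra.
by apply: has_density_double => //; apply: IH => //; lia.
Qed.

Theorem theorem1 (R : realType) :
  [/\ A1 `&` A2 = set0,
      affine1 4 (-1) M1 `&` affine1 4 1 M1 = set0
    & affine1 2 (-1) M1 `&` affine1 2 0 M1 = set0] /\
  forall l : nat, (0 < l)%N ->
  [/\ forall i j : nat, (0 < i)%N -> (0 < j)%N ->
        (diag_start l i j <-> case1 l i j \/ case2 l i j) /\
        ~ (case1 l i j /\ case2 l i j),
      forall k : nat, l = (2 ^ k.+1 - 1)%N ->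
        forall i j : nat, diag_start l i j ->
        determined_by (pd_word 1 l) l i j,
      forall k : nat, l = (3 * 2 ^ k - 1)%N ->
        forall i j : nat, diag_start l i j ->
        determined_by (pd_word (2 ^ k.+1 + 1) l) l i j
    & has_density [set p : nat * nat | diag_start l p.1 p.2]
        (density_const R l / (l%:R + 1) ^+ 2)].
Proof.
split.
  (* The disjointness claims are congruences: modulo 2 for the first and third, modulo 4 for the
     second. *)
  split; apply/seteqP; split=> // x.
  - move=> [] [/affine_M1P[a [_ _ ha]] _] [/affine_M1P[b [_ _ hb]] _].
    by move: ha; rewrite hb; lia.
  - by move=> [/affine_M1P[a [_ _ ->]] /affine_M1P[b [_ _ hb]]]; lia.
  - by move=> [/affine_M1P[a [_ _ ->]] /affine_M1P[b [_ _ hb]]]; lia.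
move=> l l0; split.
- move=> i j i0 j0; split; first exact: diag_start_cases.
  move=> [[k [e1 _]] [k' [e2 _]]].
  by apply: (@length12 l); split; [exists k|exists k'].
- by move=> k -> i j D; apply: determined_byP D (diag_start_word1 D).
- by move=> k -> i j D; apply: determined_byP D (diag_start_word2 D).
- exact: has_density_diag_starts.
Qed.
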